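(* Let $V$ be a separable left quaternionic Hilbert space, let $\mathfrak{C}\in\mathcal{GL}(V)$, and let $\Phi=\{\phi_k\}_{k\in I}$ be a $\mathfrak{C}$-controlled frame in $V$, where $I$ is a countable index set. Then $\Phi$ is a frame in $V$. Moreover, if $S$ denotes the frame operator of $\Phi$, then $\mathfrak{C}S=S\mathfrak{C}^{\dagger}$ and $$\sum_{k\in I}\langle\psi|\phi_k\rangle\,\mathfrak{C}\phi_k=\sum_{k\in I}\langle\psi|\mathfrak{C}\phi_k\rangle\,\phi_k\qquad\text{for all }\psi\in V.$$
   Context: $\mathbb{H}$ denotes the quaternions, with conjugation $q\mapsto\overline{q}$. A left quaternionic Hilbert space $V$ is a left $\mathbb{H}$-vector space with an inner product $\langle\cdot|\cdot\rangle:V\times V\to\mathbb{H}$ that is additive in each variable and satisfies $\overline{\langle f|g\rangle}=\langle g|f\rangle$, $\langle f|f\rangle>0$ for $f\ne0$, $\langle qf|g\rangle=q\langle f|g\rangle$, $\langle f|qg\rangle=\langle f|g\rangle\overline{q}$, and is complete for the norm $\|f\|^2=\langle f|f\rangle$. An operator $T$ is left linear if it is additive and $T(qf)=q(Tf)$ for $q\in\mathbb{H}$. The adjoint $T^\dagger$ is defined by $\langle\psi|T\phi\rangle=\langle T^\dagger\psi|\phi\rangle$. $\mathcal{GL}(V)$ is the set of bounded left linear operators $V\to V$ having a bounded inverse. A countable family $\{\phi_k\}_{k\in I}$ in $V$ is a frame for $V$ if there are constants $A,B>0$ with $A\|\psi\|^2\le\sum_{k\in I}|\langle\psi|\phi_k\rangle|^2\le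 B\|\psi\|^2$ for all $\psi\in V$; its frame operator is $S:V\to V$, $S\psi=\sum_{k\in I}\langle\psi|\phi_k\rangle\phi_k$. For $\mathfrak{C}\in\mathcal{GL}(V)$, a countable family $\{\phi_k\}_{k\in I}$ in $V$ is a $\mathfrak{C}$-controlled frame (a frame controlled by $\mathfrak{C}$) if there are constants $0<A_{\mathfrak{C}S}\le B_{\mathfrak{C}S}<\infty$ such that for all $\psi\in V$ $$A_{\mathfrak{C}S}\|\psi\|^2\le\sum_{k\in I}\langle\psi|\phi_k\rangle\langle\mathfrak{C}\phi_k|\psi\rangle\le B_{\mathfrak{C}S}\|\psi\|^2,$$ where the sum is understood to converge to a real number. *)

(* Defs.v *)
From HB Require Import structures.
From mathcomp Require Import all_boot all_order all_algebra finmap.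
From mathcomp Require Import ring.
From mathcomp Require Import all_classical all_reals topology normedtype.
From mathcomp Require Import sequences esum summability.

Set Implicit Arguments.
Unset Strict Implicit.
Unset Printing Implicit Defensive.

Import Order.TTheory GRing.Theory Num.Theory.
Import numFieldNormedType.Exports.

Local Open Scope classical_set_scope.
Local Open Scope ring_scope.

Reserved Notation "x %:H" (format "x %:H").
Reserved Notation "'⟨' f | g '⟩'"
  (at level 0, f at level 69, g at level 69, format "'⟨' f  |  g '⟩'").

(* Quat a b c d is the quaternion a + b i + c j + d k. *)
Record quat (R : Type) := Quat { qre : R; qi : R; qj : R; qk : R }.

Section QuatRing.
Variable R : realType.
Implicit Types (x y z : quat R) (a b : R).

Definition quat_tuple x := (qre x, qi x, qj x, qk x).
Definition tuple_quat (t : R * R * R * R) :=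
  let: (a, b, c, d) := t in Quat a b c d.

Lemma quat_tupleK : cancel quat_tuple tuple_quat.
Proof. by case. Qed.

HB.instance Definition _ := Choice.copy (quat R) (can_type quat_tupleK).

Lemma quatP x y : qre x = qre y -> qi x = qi y -> qj x = qj y ->
  qk x = qk y -> x = y.
Proof. by case: x y => [? ? ? ?] [? ? ? ?] /= -> -> -> ->. Qed.

Definition quat_opp x := Quat (- qre x) (- qi x) (- qj x) (- qk x).
Definition quat_add x y :=
  Quat (qre x + qre y) (qi x + qi y) (qj x + qj y) (qk x + qk y).
Definition quat_mul x y :=
  Quat (qre x * qre y - qi x * qi y - qj x * qj y - qk x * qk y)
       (qre x * qi y + qi x * qre y + qj x * qk y - qk x * qj y)
       (qre x * qj y - qi x * qk y + qj x * qre y + qk x * qi y)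
       (qre x * qk y + qi x * qj y - qj x * qi y + qk x * qre y).

Definition quat_of_real a := Quat a 0 0 0.
Local Notation "a %:H" := (quat_of_real a).

Fact quat_addA : associative quat_add.
Proof. by move=> x y z; apply: quatP => /=; rewrite addrA. Qed.
Fact quat_addC : commutative quat_add.
Proof. by move=> x y; apply: quatP => /=; rewrite addrC. Qed.
Fact quat_add0 : left_id 0%:H quat_add.
Proof. by move=> x; apply: quatP => /=; rewrite add0r. Qed.
Fact quat_addN : left_inverse 0%:H quat_opp quat_add.
Proof. by move=> x; apply: quatP => /=; rewrite addNr. Qed.

HB.instance Definition _ :=
  GRing.isZmodule.Build (quat R) quat_addA quat_addC quat_add0 quat_addN.

Fact quat_mulA : associative quat_mul.
Proof. by move=> x y z; apply: quatP => /=; ring. Qed.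
Fact quat_mul1 : left_id 1%:H quat_mul.
Proof. by move=> x; apply: quatP => /=; ring. Qed.
Fact quat_mulr1 : right_id 1%:H quat_mul.
Proof. by move=> x; apply: quatP => /=; ring. Qed.
Fact quat_mulDl : left_distributive quat_mul quat_add.
Proof. by move=> x y z; apply: quatP => /=; ring. Qed.
Fact quat_mulDr : right_distributive quat_mul quat_add.
Proof. by move=> x y z; apply: quatP => /=; ring. Qed.
Fact quat_1neq0 : 1%:H != 0 :> quat R.
Proof. by apply/eqP => -[] /eqP; rewrite oner_eq0. Qed.

HB.instance Definition _ := GRing.Zmodule_isNzRing.Build (quat R)
  quat_mulA quat_mul1 quat_mulr1 quat_mulDl quat_mulDr quat_1neq0.

Definition quat_conj x := Quat (qre x) (- qi x) (- qj x) (- qk x).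

Lemma quat_conjD x y : quat_conj (x + y) = quat_conj x + quat_conj y.
Proof. by apply: quatP => //=; rewrite opprD. Qed.

Lemma quat_conjM x y : quat_conj (x * y) = quat_conj y * quat_conj x.
Proof. by apply: quatP => /=; ring. Qed.

Definition quat_norm x :=
  Num.sqrt (qre x ^+ 2 + qi x ^+ 2 + qj x ^+ 2 + qk x ^+ 2).

Let sqn x := qre x ^+ 2 + qi x ^+ 2 + qj x ^+ 2 + qk x ^+ 2.

Let sqn_ge0 x : 0 <= sqn x.
Proof. by rewrite !addr_ge0 ?sqr_ge0. Qed.

Fact quat_normD x y : quat_norm (x + y) <= quat_norm x + quat_norm y.
Proof.
rewrite -(ler_pXn2r (n := 2)) ?nnegrE ?addr_ge0 ?sqrtr_ge0 //.
rewrite sqrrD /quat_norm !sqr_sqrtr ?sqn_ge0 // -sqrtrM ?sqn_ge0 //.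
set p := qre x * qre y + qi x * qi y + qj x * qj y + qk x * qk y.
have -> : qre (x + y) ^+ 2 + qi (x + y) ^+ 2 + qj (x + y) ^+ 2
    + qk (x + y) ^+ 2 = sqn x + p *+ 2 + sqn y.
  by rewrite /sqn /p /=; ring.
rewrite lerD2r lerD2l lerMn2r /=.
apply: (le_trans (ler_norm _)); rewrite -sqrtr_sqr; apply: ler_wsqrtr.
rewrite -subr_ge0.
have -> : sqn x * sqn y - p ^+ 2 =
    (qre x * qi y - qi x * qre y) ^+ 2 + (qre x * qj y - qj x * qre y) ^+ 2
  + (qre x * qk y - qk x * qre y) ^+ 2 + (qi x * qj y - qj x * qi y) ^+ 2
  + (qi x * qk y - qk x * qi y) ^+ 2 + (qj x * qk y - qk x * qj y) ^+ 2.
  by rewrite /sqn /p; ring.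
by rewrite !addr_ge0 ?sqr_ge0.
Qed.

Fact quat_norm_eq0 x : quat_norm x = 0 -> x = 0.
Proof.
move/eqP; rewrite sqrtr_eq0 => n0.
have /eqP : sqn x = 0 by apply/eqP; rewrite eq_le n0 sqn_ge0.
rewrite !paddr_eq0 ?addr_ge0 ?sqr_ge0 // !sqrf_eq0.
by move=> /andP[/andP[/andP[/eqP ? /eqP ?] /eqP ?] /eqP ?]; apply: quatP.
Qed.

Lemma quat_mulrn x n :
  x *+ n = Quat (qre x *+ n) (qi x *+ n) (qj x *+ n) (qk x *+ n).
Proof.
elim: n => [|n IHn]; first by rewrite !mulr0n.
by rewrite mulrS IHn; apply: quatP => /=; rewrite mulrS.
Qed.

Fact quat_normMn x n : quat_norm (x *+ n) = quat_norm x *+ n.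
Proof.
rewrite quat_mulrn /quat_norm /=.
have -> : (qre x *+ n) ^+ 2 + (qi x *+ n) ^+ 2 + (qj x *+ n) ^+ 2
   + (qk x *+ n) ^+ 2 = n%:R ^+ 2 * sqn x.
  by rewrite /sqn; ring.
by rewrite sqrtrM ?sqr_ge0 // sqrtr_sqr normr_nat mulr_natl.
Qed.

Fact quat_normN x : quat_norm (- x) = quat_norm x.
Proof. by rewrite /quat_norm /= !sqrrN. Qed.

HB.instance Definition _ := Num.Zmodule_isNormed.Build R (quat R)
  quat_normD quat_norm_eq0 quat_normMn quat_normN.
HB.instance Definition _ :=
  PseudoMetric.copy (quat R) (pseudoMetric_normed (quat R)).
HB.instance Definition _ := isPointed.Build (quat R) 0.
HB.instance Definition _ :=
  NormedZmod_PseudoMetric_eq.Build R (quat R) erefl.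

End QuatRing.

Notation "a %:H" := (quat_of_real a) : ring_scope.

(* The scalar action is a field of the mixin, turned below into an lmodType
   structure on V: Hierarchy Builder cannot join GRing.Lmodule (quat R) with a
   topological structure, as it expects the scalars of the join to form a
   numDomainType. The topology of V is the one of its norm, and innerE makes
   that norm the one induced by the inner product. Additivity and
   conjugate-linearity in the second variable, as well as positive
   definiteness, are derived below. *)
HB.mixin Record isLeftQuatHilbert (R : realType) V
    & PseudoMetricNormedZmod R V := {
  hilbert_complete :
    forall F : set_system V, ProperFilter F -> cauchy F -> cvg F;
  qscale : quat R -> V -> V;
  qscaleA : forall p q f, qscale p (qscale q f) = qscale (p * q) f;
  qscale1 : left_id 1 qscale;
  qscaleDr : right_distributive qscale +%R;
  qscaleDl : forall f, {morph qscale^~ f : p q / p + q};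
  inner : V -> V -> quat R;
  innerDl : forall f g h, inner (f + g) h = inner f h + inner g h;
  innerZl_subproof : forall q f g, inner (qscale q f) g = q * inner f g;
  innerC : forall f g, quat_conj (inner f g) = inner g f;
  innerE : forall f, inner f f = (`|f| ^+ 2)%:H
}.

#[short(type="leftQuatHilbertType")]
HB.structure Definition LeftQuatHilbert (R : realType) :=
  {V of PseudoMetricNormedZmod R V & isLeftQuatHilbert R V}.

#[non_forgetful_inheritance]
HB.instance Definition _ (R : realType) (V : leftQuatHilbertType R) :=
  GRing.Zmodule_isLmodule.Build (quat R) V
    qscaleA qscale1 qscaleDr qscaleDl.

Notation "'⟨' f | g '⟩'" := (inner f g) : ring_scope.

Section InnerTheory.
Context {R : realType} {V : leftQuatHilbertType R}.
Implicit Types (f g h : V) (q : quat R).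

Lemma innerZl q f g : ⟨q *: f | g⟩ = q * ⟨f | g⟩.
Proof. exact: innerZl_subproof. Qed.

Lemma innerDr f g h : ⟨f | g + h⟩ = ⟨f | g⟩ + ⟨f | h⟩.
Proof. by rewrite -innerC innerDl quat_conjD !innerC. Qed.

Lemma innerZr q f g : ⟨f | q *: g⟩ = ⟨f | g⟩ * quat_conj q.
Proof. by rewrite -innerC innerZl quat_conjM innerC. Qed.

Lemma inner_gt0 f : f != 0 -> exists2 r : R, 0 < r & ⟨f | f⟩ = r%:H.
Proof.
by move=> f0; exists (`|f| ^+ 2); rewrite ?innerE // exprn_gt0 ?normr_gt0.
Qed.

End InnerTheory.

Definition separable_space (T : topologicalType) :=
  exists2 A : set T, countable A & dense A.

(* Sums over an index set carrying no order are unconditional: they are limits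
   of the finite partial sums along the directed set of finite subsets. *)
#[global] Existing Instance totally_filter.

Section UnconditionalSums.
Context {R : realType} {I : choiceType} {W : pseudoMetricNormedZmodType R}.
Implicit Type x : I -> W.

Definition has_sum x (s : W) := partial_sum x @ totally --> s.

Definition usummable x := cvg (partial_sum x @ totally).

Definition usum x : W := lim (partial_sum x @ totally).

End UnconditionalSums.

Section Operators.
Context {R : realType} {V : leftQuatHilbertType R}.

Definition bounded_operator (T : V -> V) :=
  exists M : R, forall f, `|T f| <= M * `|f|.

Definition GL : set {linear V -> V} :=
  [set T | bounded_operator T /\
    exists T', [/\ bounded_operator T', cancel T T' & cancel T' T]].

(* The value at psi is the vector provided by the Riesz representation theorem
   when T is bounded, and unspecified if no such vector exists. *)
Definition adjoint (T : V -> V) (psi : V) : V :=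
  get [set chi | forall phi, ⟨psi | T phi⟩ = ⟨chi | phi⟩].

End Operators.

Section Frames.
Context {R : realType} {V : leftQuatHilbertType R} {I : countType}.
Implicit Type phi : I -> V.

Definition is_frame phi :=
  exists A B : R, [/\ 0 < A, 0 < B &
    forall psi : V,
      ((A * `|psi| ^+ 2)%:E <= \esum_(k in [set: I]) (`|⟨psi | phi k⟩| ^+ 2)%:E
       /\ \esum_(k in [set: I]) (`|⟨psi | phi k⟩| ^+ 2)%:E
          <= (B * `|psi| ^+ 2)%:E)%E].

Definition frame_operator phi (psi : V) : V :=
  usum (fun k => ⟨psi | phi k⟩ *: phi k).

Definition is_controlled_frame (C : V -> V) phi :=
  exists A B : R, [/\ 0 < A, A <= B &
    forall psi : V, exists s : R,
      [/\ has_sum (fun k => ⟨psi | phi k⟩ * ⟨C (phi k) | psi⟩) s%:H,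
          A * `|psi| ^+ 2 <= s & s <= B * `|psi| ^+ 2]].

End Frames.

(* Main.v *)
(* Write Q(f) for the sum over k of <f|phi_k><C phi_k|f>. Polarization recovers
   <psi|phi_k><C phi_k|chi> from Q whenever it is real, and it equals
   |<psi|phi_k>|^2 when chi solves <C f|chi> = <f|psi>, which is possible since C
   is invertible. So the sums of |<psi|phi_k>|^2 are bounded for every psi, and
   Banach-Steinhaus yields the upper frame bound B; in particular S converges.
   As <C S f|f> = Q(f) is real, C S is symmetric, whence C S = S C^dagger. The
   lower bound follows from A |f| <= |C S f| <= |C| |S f| and
   |S f|^2 <= B sum_k |<f|phi_k>|^2. *)
From HB Require Import structures.
Require Import Defs.
From mathcomp Require Import all_boot all_order all_algebra finmap.
From mathcomp Require Import ring lra.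
From mathcomp Require Import all_classical all_reals topology normedtype.
From mathcomp Require Import ereal sequences esum summability.

Set Implicit Arguments.
Unset Strict Implicit.
Unset Printing Implicit Defensive.

Import Order.TTheory GRing.Theory Num.Theory.
Import numFieldNormedType.Exports.

Local Open Scope classical_set_scope.
Local Open Scope ring_scope.

(** * Norm and conjugation of quaternions *)

Section Quaternions.
Context {R : realType}.
Implicit Types (x y : quat R) (a b : R).

Lemma sqr_normq x : `|x| ^+ 2 = qre x ^+ 2 + qi x ^+ 2 + qj x ^+ 2 + qk x ^+ 2.
Proof. by rewrite sqr_sqrtr // !addr_ge0 ?sqr_ge0. Qed.

Lemma normqM x y : `|x * y| = `|x| * `|y|.
Proof.
apply: (pexpIrn (n := 2)); rewrite ?nnegrE ?mulr_ge0 ?normr_ge0 //.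
by rewrite exprMn !sqr_normq /=; ring.
Qed.

Lemma normq_conj x : `|quat_conj x| = `|x|.
Proof.
by apply: (pexpIrn (n := 2)); rewrite ?nnegrE // !sqr_normq /= !sqrrN.
Qed.

Lemma mulq_conj x : x * quat_conj x = (`|x| ^+ 2)%:H.
Proof. by apply: quatP; rewrite ?sqr_normq /=; ring. Qed.

Lemma ler_norm_qre x : `|qre x| <= `|x|.
Proof.
rewrite -(ler_pXn2r (n := 2)) ?nnegrE // sqr_normq real_normK ?num_real //.
by rewrite -!addrA lerDl !addr_ge0 ?sqr_ge0.
Qed.

Lemma qre_le_norm x : qre x <= `|x|.
Proof. exact: le_trans (ler_norm _) (ler_norm_qre x). Qed.

Lemma normq_real a : `|a%:H| = `|a|.
Proof.
apply: (pexpIrn (n := 2)); rewrite ?nnegrE ?normr_ge0 //.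
by rewrite sqr_normq /= real_normK ?num_real //; ring.
Qed.

Lemma quat_of_realD a b : (a + b)%:H = a%:H + b%:H.
Proof. by apply: quatP; rewrite /= ?addr0. Qed.

Lemma quat_of_realM a b : (a * b)%:H = a%:H * b%:H.
Proof. by apply: quatP => /=; ring. Qed.

Lemma quat_of_real_sum (J : Type) (r : seq J) (F : J -> R) :
  (\sum_(j <- r) F j)%:H = \sum_(j <- r) (F j)%:H.
Proof. exact: (big_morph _ quat_of_realD erefl). Qed.

Lemma qre_sum (J : Type) (r : seq J) (F : J -> quat R) :
  qre (\sum_(j <- r) F j) = \sum_(j <- r) qre (F j).
Proof. exact: (big_morph (@qre R) (fun _ _ => erefl) erefl). Qed.

Definition quat_i : quat R := Quat 0 1 0 0.

Lemma normq_i : `|quat_i| = 1.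
Proof.
apply: (pexpIrn (n := 2)); rewrite ?nnegrE ?normr_ge0 ?ler01 //.
by rewrite sqr_normq /=; ring.
Qed.

End Quaternions.

(** * Inner product calculus and Cauchy-Schwarz *)

Section InnerProduct.
Context {R : realType} {V : leftQuatHilbertType R}.
Implicit Types (f g h : V) (q : quat R) (a t : R).

Lemma inner0l g : ⟨(0 : V) | g⟩ = 0.
Proof. by apply: (addrI ⟨(0 : V) | g⟩); rewrite -innerDl !addr0. Qed.

Lemma innerNl f g : ⟨- f | g⟩ = - ⟨f | g⟩.
Proof. by apply/eqP; rewrite -addr_eq0 -innerDl addNr inner0l. Qed.

Lemma innerBl f g h : ⟨f - g | h⟩ = ⟨f | h⟩ - ⟨g | h⟩.
Proof. by rewrite innerDl innerNl. Qed.

Lemma inner0r g : ⟨g | (0 : V)⟩ = 0.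
Proof. by apply: (addrI ⟨g | (0 : V)⟩); rewrite -innerDr !addr0. Qed.

Lemma innerNr f g : ⟨f | - g⟩ = - ⟨f | g⟩.
Proof. by apply/eqP; rewrite -addr_eq0 -innerDr addNr inner0r. Qed.

Lemma innerBr f g h : ⟨f | g - h⟩ = ⟨f | g⟩ - ⟨f | h⟩.
Proof. by rewrite innerDr innerNr. Qed.

Lemma inner_suml (J : Type) (r : seq J) (F : J -> V) g :
  ⟨\sum_(j <- r) F j | g⟩ = \sum_(j <- r) ⟨F j | g⟩.
Proof.
by apply: (big_morph (fun f => ⟨f | g⟩)) => [f h|]; rewrite ?innerDl ?inner0l.
Qed.

Lemma inner_sumr (J : Type) (r : seq J) (F : J -> V) g :
  ⟨g | \sum_(j <- r) F j⟩ = \sum_(j <- r) ⟨g | F j⟩.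
Proof.
by apply: (big_morph (fun f => ⟨g | f⟩)) => [f h|]; rewrite ?innerDr ?inner0r.
Qed.

Lemma sqr_normE f : `|f| ^+ 2 = qre ⟨f | f⟩.
Proof. by rewrite innerE. Qed.

Lemma norm_scaleq q f : `|q *: f| = `|q| * `|f|.
Proof.
apply: (pexpIrn (n := 2)); rewrite ?nnegrE ?mulr_ge0 ?normr_ge0 //.
rewrite exprMn !sqr_normE innerZl innerZr innerE sqr_normq /=; ring.
Qed.

Lemma inner_realZr a f g : ⟨f | a%:H *: g⟩ = a%:H * ⟨f | g⟩.
Proof. by rewrite innerZr; apply: quatP => /=; ring. Qed.

Lemma qre_innerC f g : qre ⟨f | g⟩ = qre ⟨g | f⟩.
Proof. by rewrite -innerC. Qed.

Lemma sqr_normD f g : `|f + g| ^+ 2 = `|f| ^+ 2 + qre ⟨f | g⟩ *+ 2 + `|g| ^+ 2.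
Proof.
rewrite !sqr_normE innerDl !innerDr /= (qre_innerC g f); ring.
Qed.

Lemma cauchy_schwarz f g : `|⟨f | g⟩| <= `|f| * `|g|.
Proof.
have [->|g0] := eqVneq g 0; first by rewrite inner0r normr0 mulr_ge0.
have gp : 0 < `|g| ^+ 2 by rewrite exprn_gt0 ?normr_gt0.
rewrite -(ler_pXn2r (n := 2)) ?nnegrE ?mulr_ge0 // exprMn.
rewrite -subr_ge0 -(pmulr_rge0 _ gp).
(* This vector is |g|^2 times the component of [f] orthogonal to [g]; the scaling avoids dividing by
   |g|^2. *)
set c := ⟨f | g⟩; have := sqr_ge0 `|(`|g| ^+ 2)%:H *: f + (- c) *: g|.
rewrite sqr_normD !norm_scaleq innerZl innerZr -/c normq_real normrN.
have -> : qre ((`|g| ^+ 2)%:H * (c * quat_conj (- c))) = - (`|g| ^+ 2 * `|c| ^+ 2).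
  by rewrite (sqr_normq c) /=; ring.
rewrite ger0_norm ?sqr_ge0 //.
by congr (_ <= _); ring.
Qed.

Lemma inner_inj f f' : (forall g, ⟨f | g⟩ = ⟨f' | g⟩) -> f = f'.
Proof.
move=> E; apply/eqP; rewrite -subr_eq0 -normr_eq0 -sqrf_eq0 sqr_normE.
by rewrite innerBl E subrr.
Qed.

End InnerProduct.

(** * Quaternionic polarization *)

Section Polarization.
Context {R : realType} {V : leftQuatHilbertType R}.

Definition sesquilinear (b : V -> V -> quat R) :=
  [/\ forall f g h, b (f + g) h = b f h + b g h,
      forall f g h, b f (g + h) = b f g + b f h,
      forall q f g, b (q *: f) g = q * b f g &
      forall q f g, b f (q *: g) = b f g * quat_conj q].

(** The first bracket equals [b f g + b g f]. Left multiplication by i turns the second into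
    [b f g - b g f], because the real value [b f g] commutes with i. Their sum is [2 a]. *)
Lemma polarization b f g a : sesquilinear b -> b f g = a%:H ->
  `|a| *+ 2 <= `|b (f + g) (f + g)| + `|b (f + quat_i *: g) (f + quat_i *: g)|
    + (`|b f f| + `|b g g|) *+ 2.
Proof.
move=> [bDl bDr bZl bZr] bfg.
have -> : `|a| *+ 2 = `|b (f + g) (f + g) - b f f - b g g +
    quat_i * (b (f + quat_i *: g) (f + quat_i *: g) - b f f
      - quat_i * b g g * quat_conj quat_i)|.
  rewrite -normq_real -normrMn; congr `|_|.
  rewrite !bDl !bDr !bZl !bZr bfg.
  by apply: quatP; rewrite ?quat_mulrn /=; ring.
apply: le_trans (ler_normD _ _) _.
rewrite normqM normq_i mul1r.
have tri (x y z : quat R) : `|x - y - z| <= `|x| + `|y| + `|z|.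
  rewrite (le_trans (ler_normB _ _))// lerD2r; exact: ler_normB.
apply: le_trans (lerD (tri _ _ _) (tri _ _ _)) _.
by rewrite !normqM normq_conj normq_i mul1r mulr1 mulr2n; lra.
Qed.

End Polarization.

(** * Riesz representation by minimization *)

Section Riesz.
Context {R : realType} {V : leftQuatHilbertType R}.

Theorem riesz (F : V -> quat R) (M : R) :
  {morph F : f g / f + g} -> (forall q f, F (q *: f) = q * F f) ->
  (forall f, `|F f| <= M * `|f|) -> exists chi, forall f, F f = ⟨f | chi⟩.
Proof.
move=> FD FZ FM.
(* The representing vector is the minimizer of J, which is strongly convex. *)
pose J f := `|f| ^+ 2 - qre (F f) *+ 2.
have FrM f : qre (F f) <= M * `|f| by exact: le_trans (qre_le_norm _) (FM f).
have Jlb f : - M ^+ 2 <= J f.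
  have := FrM f; have := sqr_ge0 (`|f| - M); rewrite /J sqrrB; lra.
pose E : set R := [set J f | f in setT].
have Einf : has_inf E.
  by split; [exists (J 0), 0|exists (- M ^+ 2) => _ [f _ <-]].
pose m := inf E.
have mJ f : m <= J f by apply: ge_inf; [exact: Einf.2|exists f].
pose lev (e : R) := [set f | J f < m + e].
have lev_ex e : 0 < e -> exists f, lev e f.
  by move=> e0; have [_ [f _ <-] ?] := inf_adherent e0 Einf; exists f.
have JD (t : R) f g : J (f + t%:H *: g) =
    J f + t * (qre ⟨f | g⟩ - qre (F g)) *+ 2 + t ^+ 2 * `|g| ^+ 2.
  rewrite /J sqr_normD FD FZ norm_scaleq inner_realZr /= normq_real exprMn.
  rewrite real_normK ?num_real //; ring.
have lev_dist e f g : lev e f -> lev e g -> `|f - g| ^+ 2 <= e *+ 4.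
  move=> ef eg.
  (* [J] is quadratic along the segment from [f] to [g], with leading coefficient |g - f|^2;
     comparing the midpoint, where [J] is at least [m], with the endpoints bounds this
     coefficient. *)
  have h := mJ (f + (2^-1)%:H *: (g - f)).
  have h2 : J g = J (f + 1%:H *: (g - f)) by rewrite scale1r addrC subrK.
  move: h h2 ef eg; rewrite !JD /lev /= distrC; set D := qre _ - _.
  by set X := `|g - f| ^+ 2; lra.
(* Near-minimizers form a filter base, Cauchy by [lev_dist]; its limit is the candidate. *)
pose G := filter_from [set e : R | 0 < e] lev.
have GF : ProperFilter G.
  apply: filter_from_proper; last by move=> e /= /lev_ex.
  apply: filter_from_filter; first by exists 1 => /=.
  move=> e1 e2 /= e10 e20; exists (Num.min e1 e2); first by rewrite /= lt_min e10.
  by move=> f; rewrite /lev /= -ltrBlDl lt_min => /andP[? ?]; split; rewrite -ltrBlDl.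
have Gc : cauchy G.
  apply/cauchy_ballP => e e0.
  have e20 : 0 < e ^+ 2 / 8 by rewrite divr_gt0 ?exprn_gt0.
  exists (lev (e ^+ 2 / 8), lev (e ^+ 2 / 8)).
    by split; exists (e ^+ 2 / 8).
  move=> [f g] /= [lf lg]; rewrite -ball_normE /ball_ /=.
  rewrite -(ltr_pXn2r (n := 2)) ?nnegrE ?(ltW e0) //.
  apply: le_lt_trans (lev_dist _ _ _ lf lg) _.
  by rewrite -mulr_natr; have := exprn_gt0 2 e0; lra.
pose chi : V := lim G.
have Gchi : G --> chi by exact: hilbert_complete.
have opt g : qre ⟨chi | g⟩ = qre (F g).
  have [->|g0] := eqVneq g 0.
    have /(congr1 (fun x => x - F 0)) := FD 0 0.
    by rewrite !addr0 addrK subrr inner0r => <-.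
  have ng : 0 < `|g| by rewrite normr_gt0.
  apply/eqP; rewrite -subr_eq0 -normr_le0; apply/ler_addgt0Pr => e e0.
  (* Two errors occur, from [f] not being an exact minimizer and from |chi - f|; each is at most [d]
     |g| = e / 2. *)
  rewrite add0r; pose d := e / (`|g| *+ 2).
  have d0 : 0 < d by rewrite divr_gt0 // pmulrn_rgt0.
  have levd : G (lev (d ^+ 2)) by exists (d ^+ 2); rewrite //= exprn_gt0.
  have balld : G (ball chi d) by apply: Gchi; exact: nbhsx_ballx.
  have [f [lf]] := filter_ex (filterI levd balld).
  rewrite -ball_normE /ball_ /= => bf.
  set D := qre ⟨f | g⟩ - qre (F g).
  have Dd : `|D| <= d * `|g|.
    rewrite -(ler_pXn2r (n := 2)) ?nnegrE ?(mulr_ge0 (ltW d0)) // exprMn.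
    rewrite real_normK ?num_real //.
    (* The step [- D / |g|^2] minimizes [J] on the line through [f] along [g] and lowers it by D^2 /
       |g|^2, a gain smaller than d^2 since [f] is in [lev (d ^+ 2)]. *)
    have := mJ (f + (- D / `|g| ^+ 2)%:H *: g); rewrite JD -/D.
    have n2 : `|g| ^+ 2 != 0 by rewrite expf_neq0 // normr_eq0.
    have -> : J f + - D / `|g| ^+ 2 * D *+ 2 + (- D / `|g| ^+ 2) ^+ 2 * `|g| ^+ 2
      = J f - D ^+ 2 / `|g| ^+ 2 by field; rewrite gt_eqF.
    rewrite -ler_pdivrMr ?exprn_gt0 //.
    by move: lf; rewrite /lev /=; lra.
  have -> : qre ⟨chi | g⟩ - qre (F g) = qre ⟨chi - f | g⟩ + D.
    by rewrite innerBl /D /=; ring.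
  apply: le_trans (ler_normD _ _) _.
  have h1 := le_trans (ler_norm_qre _) (cauchy_schwarz (chi - f) g).
  have h2 : `|chi - f| * `|g| <= d * `|g| by rewrite ler_pM2r // ltW.
  have : e = d * `|g| *+ 2 by rewrite /d; field; rewrite gt_eqF.
  by rewrite mulr2n => ->; lra.
exists chi => f; apply/eqP; rewrite -subr_eq0 -normr_eq0 -sqrf_eq0.
set h := F f - _.
(* [opt] sees real parts only; testing it on [quat_conj h *: f] makes the real part of the error
   equal to |h|^2. *)
have -> : `|h| ^+ 2 = qre (quat_conj h * h) by rewrite sqr_normq /=; ring.
rewrite /h mulrBr -FZ -innerZl /=; set v := _ *: f.
by rewrite -opt qre_innerC subrr.
Qed.

End Riesz.

(** * Existence of adjoints *)

Section Adjoint.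
Context {R : realType} {V : leftQuatHilbertType R}.

(** [adjoint] is a choice by [get], so it is enough that some vector qualifies; Riesz applied to
    [f ↦ ⟨T f | psi⟩] supplies one after conjugation. *)
Lemma adjointP (T : {linear V -> V}) : bounded_operator T ->
  forall psi phi, ⟨psi | T phi⟩ = ⟨adjoint T psi | phi⟩.
Proof.
move=> [M TM] psi.
suff [chi chiP] : exists chi, forall phi, ⟨T phi | psi⟩ = ⟨phi | chi⟩.
  apply: (@getPex V (fun chi => forall phi, ⟨psi | T phi⟩ = ⟨chi | phi⟩)).
  by exists chi => phi; rewrite -innerC chiP innerC.
apply: (@riesz R V (fun f => ⟨T f | psi⟩) (M * `|psi|)).
- by move=> f g; rewrite linearD innerDl.
- by move=> q f; rewrite linearZ innerZl.
- move=> f; apply: le_trans (cauchy_schwarz _ _) _.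
  by rewrite mulrAC ler_wpM2r.
Qed.

Lemma bounded_operator_gt0 (T : V -> V) : bounded_operator T ->
  exists2 M : R, 0 < M & forall f, `|T f| <= M * `|f|.
Proof.
move=> [M TM]; exists (`|M| + 1); first by rewrite ltr_wpDl.
move=> f; apply: le_trans (TM f) _; rewrite ler_wpM2r //.
by rewrite (le_trans (ler_norm M)) // lerDl.
Qed.

End Adjoint.

(** * Uniform boundedness over the real scalars *)

Section RealStructure.
Context {R : realType}.

(* An alias of V carrying its real scalars: the library states Banach-Steinhaus
   for normed modules over R, while V is an lmodType over the quaternions. *)
Definition realify (V : leftQuatHilbertType R) : Type := V.

Variable V : leftQuatHilbertType R.

HB.instance Definition _ := PseudoMetricNormedZmod.copy (realify V) V.

Definition rscale (a : R) (f : realify V) : realify V := (a%:H *: (f : V)).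

Fact rscaleA a b f : rscale a (rscale b f) = rscale (a * b) f.
Proof. by rewrite /rscale scalerA quat_of_realM. Qed.

Fact rscale1 : left_id 1 rscale.
Proof. by move=> f; rewrite /rscale scale1r. Qed.

Fact rscaleDr : right_distributive rscale +%R.
Proof. by move=> a f g; rewrite /rscale scalerDr. Qed.

Fact rscaleDl f : {morph rscale^~ f : a b / a + b}.
Proof. by move=> a b; rewrite /rscale quat_of_realD scalerDl. Qed.

HB.instance Definition _ := GRing.Zmodule_isLmodule.Build R (realify V)
  rscaleA rscale1 rscaleDr rscaleDl.

Fact norm_rscale (a : R) (f : realify V) : `|a *: f| = `|a| * `|f|.
Proof. by rewrite [LHS]norm_scaleq normq_real. Qed.

HB.instance Definition _ :=
  PseudoMetricNormedZmod_Lmodule_isNormedModule.Build R (realify V) norm_rscale.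

HB.instance Definition _ := Uniform_isComplete.Build (realify V)
  (@hilbert_complete R V).

(** Banach-Steinhaus for the real functionals [psi ↦ qre ⟨psi | v⟩], [v] in [D]; evaluating at the
    unit vector v / |v| returns |v|. *)
Lemma weakly_bounded_bounded (D : set V) :
  (forall psi : V, exists M : R, forall v, D v -> `|⟨psi | v⟩| <= M) ->
  exists M : R, forall v, D v -> `|v| <= M.
Proof.
move=> wb.
pose ev (v : V) (psi : realify V) : R^o := qre ⟨(psi : V) | v⟩.
have [|psi|M MP] := @Banach_Steinhauss R (realify V) R^o [set ev v | v in D] _ _ 1.
- move=> _ [v Dv <-]; split.
    move=> r; exists (r * `|v|) => f fr; rewrite /ev.
    apply: le_trans (ler_norm_qre _) _; apply: le_trans (cauchy_schwarz _ _) _.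
    by rewrite ler_wpM2r.
  by move=> a f g; rewrite /ev innerDl innerZl /= !mul0r !subr0.
- have [M MP] := wb psi; exists M => _ [v Dv <-].
  exact: le_trans (ler_norm_qre _) (MP v Dv).
exists M => v Dv.
have [->|v0] := eqVneq v 0.
  have /(_ 0) := MP (ev v) (imageP _ Dv); rewrite !normr0.
  by move=> /(_ ler01); apply: le_trans.
have nv : 0 < `|v| by rewrite normr_gt0.
have /(_ (`|v|^-1%:H *: v)) := MP (ev v) (imageP _ Dv).
rewrite norm_scaleq normq_real normfV normr_id mulVf ?gt_eqF // => /(_ (lexx _)).
rewrite /ev innerZl innerE /= !mul0r !subr0.
rewrite expr2 mulrA mulVf ?gt_eqF // mul1r.
by rewrite normr_id.
Qed.

End RealStructure.

(** * Unconditional sums over finite subsets *)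

Lemma sum_fsetD (I : choiceType) (W : nmodType) (x : I -> W) (A A0 : {fset I}) :
  (A0 `<=` A)%fset ->
  \sum_(k <- A) x k =
    \sum_(k <- A0) x k + \sum_(k <- (A `\` A0)%fset) x k.
Proof.
move=> sA; rewrite -big_cat; apply: perm_big; apply: uniq_perm => //.
  rewrite cat_uniq !fset_uniq andbT; apply/hasPn => k.
  by rewrite /= in_fsetD => /andP[].
move=> k; rewrite mem_cat in_fsetD.
by have [/(fsubsetP sA) ->|] := boolP (k \in A0).
Qed.

Section Sums.
Context {R : realType} {I : choiceType} {W : pseudoMetricNormedZmodType R}.
Implicit Types (x : I -> W) (s : W) (A : {fset I}).

Lemma partial_sumE x A : partial_sum x A = \sum_(k <- A) x k.
Proof. by rewrite big_seq_fsetE. Qed.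

Lemma has_sumP x s : has_sum x s <-> forall e, 0 < e ->
  exists A0, forall A, (A0 `<=` A)%fset -> `|s - \sum_(k <- A) x k| < e.
Proof.
split=> [/cvgrPdist_lt xs e /xs [A0 _ A0P]|xs].
  by exists A0 => A /A0P /=; rewrite partial_sumE.
apply/cvgrPdist_lt => e /xs[A0 A0P].
by exists A0 => // A /A0P /=; rewrite partial_sumE.
Qed.

Lemma has_sum_usum x s : has_sum x s -> usum x = s.
Proof. by move=> xs; apply: cvg_lim => //; exact: norm_hausdorff. Qed.

Lemma has_sum_usummable x s : has_sum x s -> usummable x.
Proof. exact: cvgP. Qed.

Lemma has_sum_unique x s s' : has_sum x s -> has_sum x s' -> s = s'.
Proof. by move=> /has_sum_usum <- /has_sum_usum. Qed.

(** The part of [A] outside [A0] contributes a difference of two partial sums containing [A0], both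
    within 1 of [s], hence at most 2; the part inside is bounded termwise. *)
Lemma has_sum_bounded x s : has_sum x s ->
  exists K : R, forall A, `|\sum_(k <- A) x k| <= K.
Proof.
move=> /has_sumP /(_ 1 ltr01) [A0 A0P].
exists (2 + \sum_(k <- A0) `|x k|) => A.
rewrite (sum_fsetD x (fsubsetIl A A0)) fsetDIr fsetDv fset0U addrC.
apply: le_trans (ler_normD _ _) (lerD _ _).
  have := A0P _ (fsubsetUl A0 A); have := A0P _ (fsubset_refl A0).
  rewrite (sum_fsetD x (fsubsetUl A0 A)) fsetDUl fsetDv fset0U.
  set u := \sum_(k <- A0) _; set v := \sum_(k <- _) _ => h1 h2.
  have -> : v = (s - u) - (s - (u + v)).
    by rewrite opprB addrC addrA subrK addrC addKr.
  by apply: le_trans (ler_normB _ _) _; lra.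
rewrite (sum_fsetD (fun k => `|x k|) (fsubsetIr A A0)).
by rewrite ler_wpDr ?sumr_ge0 // ler_norm_sum.
Qed.

Lemma has_sum_norm_le x s (K : R) : has_sum x s ->
  (forall A, `|\sum_(k <- A) x k| <= K) -> `|s| <= K.
Proof.
move=> /has_sumP xs xK; apply/ler_addgt0Pr => e /xs[A0 /(_ _ (fsubset_refl _)) h].
rewrite -(subrK (\sum_(k <- A0) x k) s).
by have := xK A0; have := ler_normD (s - \sum_(k <- A0) x k) (\sum_(k <- A0) x k); lra.
Qed.

End Sums.

Lemma has_sum_map (R : realType) (I : choiceType)
    (W W' : pseudoMetricNormedZmodType R) (f : W -> W') (M : R) (x : I -> W) s :
  {morph f : u v / u - v} -> (forall u, `|f u| <= M * `|u|) ->
  has_sum x s -> has_sum (f \o x) (f s).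
Proof.
move=> fB fM /has_sumP xs; apply/has_sumP => e e0.
(* [M] may be zero or negative, so |M| + 1 serves as the divisor. *)
have M0 : 0 < `|M| + 1 by rewrite ltr_wpDl.
have [A0 A0P] := xs (e / (`|M| + 1)) (divr_gt0 e0 M0).
have f0 : f 0 = 0 by rewrite -(subrr 0) fB subrr.
have fD : {morph f : u v / u + v}.
  by move=> u v; rewrite -{1}[v]opprK -(sub0r v) !fB f0 sub0r opprK.
exists A0 => A /A0P; rewrite ltr_pdivlMr // mulrC; apply: le_lt_trans.
rewrite -(big_morph f fD f0) -fB; apply: le_trans (fM _) _.
by rewrite ler_wpM2r // (le_trans (ler_norm _)) // lerDl.
Qed.

(** [A0] is a finite set whose sum comes within [e] of the supremum of all finite sums. *)
Lemma nneg_sum_tail (R : realType) (I : choiceType) (a : I -> R) (K e : R) :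
  (forall k, 0 <= a k) -> (forall A : {fset I}, \sum_(k <- A) a k <= K) -> 0 < e ->
  exists A0 : {fset I}, forall A, (A0 `<=` A)%fset ->
    \sum_(k <- (A `\` A0)%fset) a k < e.
Proof.
move=> a0 aK e0; pose E : set R := [set \sum_(k <- A) a k | A in [set: {fset I}]].
have supE : has_sup E.
  by split; [exists (\sum_(k <- fset0) a k), fset0|exists K => _ [A _ <-]].
have [_ [A0 _ <-] lt] := sup_adherent e0 supE; exists A0 => A sA.
have : \sum_(k <- A) a k <= sup E by apply: ub_le_sup; [exact: supE.2|exists A].
by rewrite (sum_fsetD a sA); lra.
Qed.

(** * Bessel families and the synthesis operator *)

Section Bessel.
Context {R : realType} {V : leftQuatHilbertType R} {I : choiceType}.
Implicit Types (phi : I -> V) (B : R) (A : {fset I}) (psi : V).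

(** The upper frame inequality, put on finite sums so that it applies directly to partial sums of
    the frame operator. *)
Definition bessel phi B := forall psi A,
  \sum_(k <- A) `|⟨psi | phi k⟩| ^+ 2 <= B * `|psi| ^+ 2.

(** Pairing the sum [v] with itself produces the coefficients [⟨v | phi k⟩]; weighted by 1 / B,
    their squares add up to at most |v|^2 and are absorbed on the left. *)
Lemma bessel_synthesis phi B (c : I -> quat R) A : 0 < B -> bessel phi B ->
  `|\sum_(k <- A) c k *: phi k| ^+ 2 <= B * \sum_(k <- A) `|c k| ^+ 2.
Proof.
move=> B0 bB; set v := \sum_(k <- A) _.
(* AM-GM: [2 |c k| |<v|phi k>| <= B |c k|^2 + |<v|phi k>|^2 / B] *)
have h : `|v| ^+ 2 *+ 2 <= \sum_(k <- A) (B * `|c k| ^+ 2 + `|⟨v | phi k⟩| ^+ 2 / B).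
  rewrite sqr_normE {1}/v inner_suml qre_sum -sumrMnl ler_sum // => k _.
  rewrite innerZl; apply: le_trans (_ : (`|c k| * `|⟨v | phi k⟩|) *+ 2 <= _).
    by rewrite ler_wMn2r // (le_trans (qre_le_norm _)) // normqM -(innerC v) normq_conj.
  rewrite -subr_ge0; set c' := `|c k|; set d := `|⟨v | phi k⟩|.
  have -> : B * c' ^+ 2 + d ^+ 2 / B - c' * d *+ 2 = (B * c' - d) ^+ 2 / B.
    by field; rewrite gt_eqF.
  by rewrite divr_ge0 ?sqr_ge0 // ltW.
have := bB v A; rewrite mulrC -ler_pdivrMr // mulr_suml => h2.
by move: h; rewrite big_split /= -mulr_sumr; lra.
Qed.

Lemma bessel_usummable phi B (c : I -> quat R) K : 0 < B -> bessel phi B ->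
  (forall A, \sum_(k <- A) `|c k| ^+ 2 <= K) ->
  usummable (fun k => c k *: phi k).
Proof.
move=> B0 bB cK; apply: hilbert_complete; apply/cauchy_ballP => e e0.
(* With this tail bound [bessel_synthesis] makes every block outside [A0] shorter than e / 2, and
   two partial sums over [A0] differ by two such blocks. *)
have e1 : 0 < e ^+ 2 / (B * 4) by rewrite divr_gt0 ?exprn_gt0 ?mulr_gt0.
have [A0 A0P] := nneg_sum_tail (fun k => sqr_ge0 `|c k|) cK e1.
pose N := [set A : {fset I} | (A0 `<=` A)%fset].
have NA : totally N by exists A0.
have tail A : N A -> `|\sum_(k <- (A `\` A0)%fset) c k *: phi k| < e / 2.
  move=> /A0P h; rewrite -(ltr_pXn2r (n := 2)) ?nnegrE ?divr_ge0 ?(ltW e0) //.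
  apply: le_lt_trans (bessel_synthesis _ _ B0 bB) _.
  rewrite mulrC -ltr_pdivlMr //; apply: lt_le_trans h _.
  by rewrite le_eqVlt; apply/orP; left; apply/eqP; field; rewrite gt_eqF.
pose p := partial_sum (fun k => c k *: phi k).
exists (p @` N, p @` N).
  by split; apply: filterS NA => A NA'; exists A.
move=> [_ _] /= [[A NA' <-] [A' NA'' <-]]; rewrite -ball_normE /ball_ /=.
rewrite /p !partial_sumE (sum_fsetD _ NA') (sum_fsetD _ NA'').
rewrite opprD addrACA subrr add0r.
by apply: le_lt_trans (ler_normB _ _) _; have := tail _ NA'; have := tail _ NA''; lra.
Qed.

(** By duality: [D] is the image under synthesis of the finitely supported unit l2 coefficients.
    Pointwise square sums make [D] weakly bounded, hence bounded, and its bound controls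
    analysis. *)
Lemma pointwise_bessel phi :
  (forall psi, exists K, forall A, \sum_(k <- A) `|⟨psi | phi k⟩| ^+ 2 <= K) ->
  exists2 B, 0 < B & bessel phi B.
Proof.
move=> pw.
pose D := [set v | exists A (c : I -> quat R),
  \sum_(k <- A) `|c k| ^+ 2 <= 1 /\ v = \sum_(k <- A) c k *: phi k].
have [|M MP] := @weakly_bounded_bounded R V D.
  move=> psi; have [K KP] := pw psi; exists (K + 1) => _ [A [c [c1 ->]]].
  rewrite inner_sumr; apply: le_trans (ler_norm_sum _ _ _) _.
  apply: le_trans (lerD (KP A) c1); rewrite -big_split ler_sum // => k _ /=.
  rewrite innerZr normqM normq_conj.
  have := sqr_ge0 (`|⟨psi | phi k⟩| - `|c k|); rewrite sqrrB.
  have := sqr_ge0 `|⟨psi | phi k⟩|; have := sqr_ge0 `|c k|; lra.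
exists (M ^+ 2 + 1); first by rewrite ltr_wpDl ?sqr_ge0.
move=> psi A; set s := \sum_(k <- A) _.
have s0 : 0 <= s by rewrite sumr_ge0 // => k _; exact: sqr_ge0.
apply: le_trans (_ : M ^+ 2 * `|psi| ^+ 2 <= _); last first.
  by rewrite ler_wpM2r ?sqr_ge0 // lerDl.
have [->|sn0] := eqVneq s 0; first by rewrite mulr_ge0 ?sqr_ge0.
have sp : 0 < s by rewrite lt_def sn0.
(* The normalized coefficients of [psi] attain equality in Cauchy-Schwarz: pairing [psi] with their
   synthesis gives exactly the square root of [s]. *)
pose c k := (Num.sqrt s)^-1%:H * ⟨psi | phi k⟩.
have r0 : 0 < Num.sqrt s by rewrite sqrtr_gt0.
have r2 : Num.sqrt s ^+ 2 = s by rewrite sqr_sqrtr.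
have Dv : D (\sum_(k <- A) c k *: phi k).
  exists A, c; split=> //; rewrite /c.
  under eq_bigr do rewrite normqM exprMn normq_real.
  by rewrite -mulr_sumr -/s real_normK ?num_real // exprVn r2 mulVf.
have : Num.sqrt s <= `|psi| * M.
  apply: le_trans (_ : `|psi| * `|\sum_(k <- A) c k *: phi k| <= _); last first.
    by rewrite ler_wpM2l // MP.
  apply: le_trans (cauchy_schwarz _ _); apply: le_trans (qre_le_norm _).
  rewrite inner_sumr qre_sum (eq_bigr (fun k => (Num.sqrt s)^-1 * `|⟨psi | phi k⟩| ^+ 2)).
    by rewrite -mulr_sumr -/s -{3}r2 expr2 mulrA mulVf ?mul1r // gt_eqF.
  by move=> k _; rewrite innerZr /c sqr_normq /=; ring.
move=> h; rewrite mulrC -exprMn -{1}r2 ler_pXn2r // ?nnegrE ?(ltW r0) //.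
exact: le_trans (ltW r0) h.
Qed.

End Bessel.

(** * Linearity and symmetry read off the inner product *)

Section FormalAdjoint.
Context {R : realType} {V : leftQuatHilbertType R}.

(** Supplies the linearity of the frame operator, which is defined as a bare limit. *)
Lemma formal_adjoint_linear (T T' : V -> V) :
  (forall f g, ⟨T f | g⟩ = ⟨f | T' g⟩) ->
  {morph T : f g / f + g} /\ forall q f, T (q *: f) = q *: T f.
Proof.
by move=> TT'; split=> [f g|q f]; apply: inner_inj => h;
  rewrite ?innerDl ?innerZl !TT' ?innerDl ?innerZl.
Qed.

(** The defect of symmetry [b] is sesquilinear and zero on the diagonal, where [⟨T f | f⟩] equals
    its conjugate; polarization then kills it. *)
Lemma real_form_symmetric (T : V -> V) :
  {morph T : f g / f + g} -> (forall q f, T (q *: f) = q *: T f) ->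
  (forall f, exists a : R, ⟨T f | f⟩ = a%:H) ->
  forall f g, ⟨T f | g⟩ = ⟨f | T g⟩.
Proof.
move=> TD TZ Treal f g; set b := fun f g : V => ⟨T f | g⟩ - ⟨f | T g⟩.
have bS : sesquilinear b.
  split=> [u v w|u v w|q u v|q u v]; rewrite /b ?TD ?TZ.
  - by rewrite !innerDl opprD addrACA.
  - by rewrite !innerDr opprD addrACA.
  - by rewrite !innerZl mulrBr.
  - by rewrite !innerZr mulrBl.
have b0 u : b u u = 0.
  rewrite /b -(innerC (T u) u); have [a ->] := Treal u.
  by apply: quatP => /=; ring.
(* [polarization] asks for a real value; rescaling [g] by [b f g] provides one. *)
have bfZ : b f (b f g *: g) = (`|b f g| ^+ 2)%:H.
  by case: bS => _ _ _ ->; rewrite mulq_conj.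
have := polarization bS bfZ; rewrite !b0 normr0 !addr0 mul0rn addr0 pmulrn_lle0 //.
rewrite normr_le0 sqrf_eq0 normr_eq0 => /eqP bfg0.
by apply/eqP; rewrite -subr_eq0; apply/eqP.
Qed.

End FormalAdjoint.

(** * The frame operator of a Bessel family *)

Section FrameOperator.
Context {R : realType} {V : leftQuatHilbertType R} {I : countType}.
Variables (phi : I -> V) (B : R).
Hypotheses (B0 : 0 < B) (bB : bessel phi B).

Lemma frame_operator_has_sum psi :
  has_sum (fun k => ⟨psi | phi k⟩ *: phi k) (frame_operator phi psi).
Proof. exact: bessel_usummable B0 bB (bB psi). Qed.

Lemma frame_operator_symmetric f g :
  ⟨frame_operator phi f | g⟩ = ⟨f | frame_operator phi g⟩.
Proof.
have bnd u : `|⟨u | g⟩| <= `|g| * `|u| by rewrite mulrC cauchy_schwarz.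
have hf := has_sum_map (fun u v => innerBl u v g) bnd
  (@frame_operator_has_sum f).
have hg := has_sum_map (fun u v => innerBr f u v)
  (fun u => cauchy_schwarz f u) (@frame_operator_has_sum g).
apply: has_sum_unique hf _.
congr has_sum: hg; apply/funext => k /=.
by rewrite innerZl innerZr innerC.
Qed.

(** Keeping the square sum [e] instead of replacing it by [B] |psi|^2 is what later gives the lower
    frame bound. *)
Lemma sqr_norm_frame_operator_le psi e :
  (forall A : {fset I}, \sum_(k <- A) `|⟨psi | phi k⟩| ^+ 2 <= e) ->
  `|frame_operator phi psi| ^+ 2 <= B * e.
Proof.
move=> Ae.
have e0 : 0 <= e by have := Ae fset0; rewrite big_nil.
have Be0 : 0 <= B * e by rewrite mulr_ge0 // ltW.
rewrite -[leRHS]sqr_sqrtr // ler_pXn2r ?nnegrE ?sqrtr_ge0 //.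
apply: has_sum_norm_le (@frame_operator_has_sum psi) _ => A.
rewrite -(ler_pXn2r (n := 2)) ?nnegrE ?sqrtr_ge0 // sqr_sqrtr //.
apply: le_trans (bessel_synthesis _ _ B0 bB) _.
by rewrite ler_pM2l.
Qed.

End FrameOperator.

(** * Controlled frames are Bessel *)

Section ControlledFrames.
Context {R : realType} {V : leftQuatHilbertType R} {I : countType}.
Implicit Types (phi : I -> V) (C : {linear V -> V}).

(** The solution is the adjoint of the inverse of [C] applied to [psi]. *)
Lemma GL_adjoint_surjective C psi : GL C ->
  exists chi, forall f, ⟨C f | chi⟩ = ⟨f | psi⟩.
Proof.
move=> [_ [C' [[M C'M] CK C'K]]].
have [||f|chi chiP] := @riesz R V (fun f => ⟨C' f | psi⟩) (M * `|psi|).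
(* Linearity of the inverse [C'] is deduced from that of [C] by injectivity. *)
- by move=> f g; rewrite -innerDl; congr ⟨_ | _⟩; apply: (can_inj CK);
  rewrite linearD !C'K.
- by move=> q f; rewrite -innerZl; congr ⟨_ | _⟩; apply: (can_inj CK);
  rewrite linearZ !C'K.
- by apply: le_trans (cauchy_schwarz _ _) _; rewrite mulrAC ler_wpM2r.
by exists chi => f; rewrite -chiP CK.
Qed.

Lemma controlled_frame_bessel C phi : GL C -> is_controlled_frame C phi ->
  exists2 B : R, 0 < B & bessel phi B.
Proof.
move=> GLC [lo [up [_ _ ctrl]]]; apply: pointwise_bessel => psi.
have [chi chiP] := GL_adjoint_surjective psi GLC.
pose b A f g := \sum_(k <- A : {fset I}) ⟨f | phi k⟩ * ⟨C (phi k) | g⟩.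
have bS A : sesquilinear (b A).
  split=> [u v w|u v w|q u v|q u v]; rewrite /b.
  - by rewrite -big_split; apply: eq_bigr => k _; rewrite innerDl mulrDl.
  - by rewrite -big_split; apply: eq_bigr => k _; rewrite innerDr mulrDr.
  - by rewrite mulr_sumr; apply: eq_bigr => k _; rewrite innerZl mulrA.
  - by rewrite mulr_suml; apply: eq_bigr => k _; rewrite innerZr mulrA.
(* Convergence of the controlled sum at [u] bounds the truncated forms on the diagonal uniformly in
   [A]. *)
have bK u : exists K : R, forall A, `|b A u u| <= K.
  by have [s [/has_sum_bounded]] := ctrl u.
have breal A : b A psi chi = (\sum_(k <- A) `|⟨psi | phi k⟩| ^+ 2)%:H.
  rewrite quat_of_real_sum; apply: eq_bigr => k _.
  by rewrite chiP -mulq_conj innerC.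
have [K1 K1P] := bK (psi + chi); have [K2 K2P] := bK (psi + quat_i *: chi).
have [K3 K3P] := bK psi; have [K4 K4P] := bK chi.
exists (K1 + K2 + (K3 + K4) *+ 2) => A.
have := polarization (bS A) (breal A).
have := K1P A; have := K2P A; have := K3P A; have := K4P A.
set s := \sum_(k <- A) _; have := ler_norm s; have := normr_ge0 s.
have := normr_ge0 (b A psi psi); have := normr_ge0 (b A chi chi).
lra.
Qed.

End ControlledFrames.

(** * Extended-real sums against finite sums *)

Section EsumBounds.
Context {R : realType} {I : choiceType}.
Variable a : I -> R.

Lemma esum_le_real K : (forall A : {fset I}, \sum_(k <- A) a k <= K) ->
  (\esum_(k in [set: I]) (a k)%:E <= K%:E)%E.
Proof.
move=> aK; apply: ge_ereal_sup => _ [X [finX _] <-].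
by rewrite fsbig_finite // sumEFin lee_fin.
Qed.

Lemma sum_le_esum (A : {fset I}) :
  ((\sum_(k <- A) a k)%:E <= \esum_(k in [set: I]) (a k)%:E)%E.
Proof.
apply: esum_ge; exists [set` A]; first by split; [exact: finite_fset|].
by rewrite fsbig_finite ?set_fsetK // sumEFin.
Qed.

End EsumBounds.

(** * Composing [C] with the frame operator *)

Section ControlledFrameOperator.
Context {R : realType} {V : leftQuatHilbertType R} {I : countType}.
Variables (C : {linear V -> V}) (phi : I -> V) (B : R).
Hypotheses (GLC : GL C) (B0 : 0 < B) (bB : bessel phi B).
Local Notation S := (frame_operator phi).

Lemma comp_frame_operator_has_sum psi :
  has_sum (fun k => ⟨psi | phi k⟩ *: C (phi k)) (C (S psi)).
Proof.
have [[M CM] _] := GLC.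
have := has_sum_map (fun u v => linearB C u v) CM
  (@frame_operator_has_sum _ _ _ _ _ B0 bB psi).
by congr has_sum; apply/funext => k /=; rewrite linearZ.
Qed.

(** Moving [C] onto [psi] turns the terms into those of [S] at [adjoint C psi]. *)
Lemma frame_operator_adjoint_has_sum psi :
  has_sum (fun k => ⟨psi | C (phi k)⟩ *: phi k) (S (adjoint C psi)).
Proof.
under eq_fun do rewrite (adjointP GLC.1).
exact: (@frame_operator_has_sum _ _ _ _ _ B0 bB).
Qed.

Lemma inner_comp_frame_operator_has_sum psi :
  has_sum (fun k => ⟨psi | phi k⟩ * ⟨C (phi k) | psi⟩) ⟨C (S psi) | psi⟩.
Proof.
have bnd u : `|⟨u | psi⟩| <= `|psi| * `|u| by rewrite mulrC cauchy_schwarz.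
have := has_sum_map (fun u v => innerBl u v psi) bnd
  (@comp_frame_operator_has_sum psi).
by congr has_sum; apply/funext => k /=; rewrite innerZl.
Qed.

(** With [C \o S] and [S] both symmetric, [⟨C (S f) | g⟩] = [⟨f | C (S g)⟩] = [⟨adjoint C f | S g⟩]
    = [⟨S (adjoint C f) | g⟩]. *)
Lemma comp_frame_operatorC :
  (forall psi, exists s : R,
    has_sum (fun k => ⟨psi | phi k⟩ * ⟨C (phi k) | psi⟩) s%:H) ->
  C \o S = S \o adjoint C.
Proof.
move=> Creal; have Ssym := frame_operator_symmetric B0 bB.
have [SD SZ] := formal_adjoint_linear Ssym.
have CSsym : forall f g, ⟨C (S f) | g⟩ = ⟨f | C (S g)⟩.
  apply: (real_form_symmetric (T := C \o S)) => [f g|q f|f] /=.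
  - by rewrite SD linearD.
  - by rewrite SZ linearZ.
  - have [s hs] := Creal f; exists s.
    exact: has_sum_unique (@inner_comp_frame_operator_has_sum f) hs.
apply/funext => f; apply: inner_inj => g /=.
by rewrite CSsym (adjointP GLC.1) Ssym.
Qed.

End ControlledFrameOperator.

Theorem proposition3p2 (R : realType) (V : leftQuatHilbertType R)
    (sepV : separable_space V) (C : {linear V -> V}) (GLC : GL C)
    (I : countType) (phi : I -> V) (ctrl : is_controlled_frame C phi) :
  let S := frame_operator phi in
  [/\ is_frame phi,
      (forall psi : V, usummable (fun k => ⟨psi | phi k⟩ *: phi k)),
      C \o S = S \o adjoint C &
      forall psi : V,
        [/\ usummable (fun k => ⟨psi | phi k⟩ *: C (phi k)),
            usummable (fun k => ⟨psi | C (phi k)⟩ *: phi k) &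
            usum (fun k => ⟨psi | phi k⟩ *: C (phi k)) =
            usum (fun k => ⟨psi | C (phi k)⟩ *: phi k)]].
Proof.
move=> S.
have [B B0 bB] := controlled_frame_bessel GLC ctrl.
have [A [B' [A0 _ bnd]]] := ctrl.
have CS : C \o S = S \o adjoint C.
  apply: comp_frame_operatorC GLC B0 bB _ => psi.
  by have [s [hs _ _]] := bnd psi; exists s.
have hS psi := @frame_operator_has_sum _ _ _ _ _ B0 bB psi.
have hCS psi := @comp_frame_operator_has_sum _ _ _ _ _ _ GLC B0 bB psi.
have hin psi := @inner_comp_frame_operator_has_sum _ _ _ _ _ _ GLC B0 bB psi.
have hSC psi := @frame_operator_adjoint_has_sum _ _ _ _ _ _ GLC B0 bB psi.
split=> // [|psi]; last first.
  split; [exact: has_sum_usummable (hCS psi)|exact: has_sum_usummable (hSC psi)|].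
  rewrite (has_sum_usum (hCS psi)) (has_sum_usum (hSC psi)).
  exact: (congr1 (fun T => T psi) CS).
have [M M0 CM] := bounded_operator_gt0 GLC.1.
have MB0 : 0 < M ^+ 2 * B by rewrite mulr_gt0 // exprn_gt0.
(* The lower constant combines [A] |psi| <= [M] |S psi| with |S psi|^2 <= [B e], where [e] is the
   square sum of the frame coefficients. *)
exists (A ^+ 2 / (M ^+ 2 * B)), B; split=> //; first by rewrite divr_gt0 ?exprn_gt0.
move=> psi; have up := esum_le_real (bB psi); split=> //.
(* Finiteness, from the upper bound, lets the remaining estimate be carried out in the reals. *)
have Afin : (\esum_(k in [set: I]) (`|⟨psi | phi k⟩| ^+ 2)%:E)%E \is a fin_num.
  rewrite ge0_fin_numE; first exact: le_lt_trans up (ltry _).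
  by apply: esum_ge0 => k _; rewrite lee_fin.
move: (sum_le_esum (fun k => `|⟨psi | phi k⟩| ^+ 2)).
rewrite -(fineK Afin); set e := fine _ => ue; rewrite lee_fin.
have Se : `|S psi| ^+ 2 <= B * e.
  by apply: (sqr_norm_frame_operator_le B0 bB) => J; have := ue J; rewrite lee_fin.
rewrite mulrAC ler_pdivrMr //.
have ASM : A * `|psi| <= M * `|S psi|.
  have [->|psi0] := eqVneq psi 0; first by rewrite normr0 mulr0 mulr_ge0 // ltW.
  rewrite -(ler_pM2r (_ : 0 < `|psi|)) ?normr_gt0 // -mulrA -expr2.
  have [s [hs As _]] := bnd psi; apply: le_trans As _.
  have -> : s = qre ⟨C (S psi) | psi⟩.
    by rewrite (has_sum_unique (hin psi) hs).
  apply: le_trans (qre_le_norm _) _; apply: le_trans (cauchy_schwarz _ _) _.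
  by rewrite ler_wpM2r.
have : (A * `|psi|) ^+ 2 <= (M * `|S psi|) ^+ 2.
  by rewrite ler_pXn2r // nnegrE mulr_ge0 // ltW.
rewrite !exprMn => /le_trans; apply.
have -> : e * (M ^+ 2 * B) = M ^+ 2 * (B * e) by ring.
by rewrite ler_pM2l ?exprn_gt0.
Qed.
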